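(* For every $k\geq 2$, $H_k\in\mathcal{G}_s^s$. In particular, for every $n\geq 9$ there is a non-planar $n$-vertex graph in $\mathcal{G}_s^s$.
   Context: For $k\geq 2$, $H_k$ is the graph with vertices $v_1,\ldots,v_{2k},u_1,\ldots,u_k$ whose edges are the cycle edges $v_1v_2,v_2v_3,\ldots,v_{2k-1}v_{2k},v_{2k}v_1$, together with $u_iv_{2i}$ for all $i\in\{1,\ldots,k\}$, $u_iv_{2i+3}$ for all $i\in\{1,\ldots,k-2\}$, $u_{k-1}v_1$ and $u_kv_3$. A finite point set $X\subseteq\mathbb{R}^2$ is strictly convex if every point of $X$ is a vertex of its convex hull. A drawing of a graph is a map of its vertices to $\mathbb{R}^2$, edges drawn as straight segments, such that no two vertices coincide, no two edge midpoints coincide, and no edge midpoint coincides with a vertex. $\mathcal{G}_s^s$ is the class of graphs admitting a drawing whose vertex set and edge-midpoint set are both strictly convex. *)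

(* Defs.v *)
From HB Require Import structures.
From mathcomp Require Import all_boot all_order all_algebra.
From mathcomp Require Import all_classical all_reals all_analysis.

Set Implicit Arguments.
Unset Strict Implicit.
Unset Printing Implicit Defensive.

Import Order.TTheory GRing.Theory Num.Theory.
Import numFieldNormedType.Exports.

Local Open Scope classical_set_scope.
Local Open Scope ring_scope.

Record sgraph := SGraph {
  vertex :> finType;
  adj : rel vertex;
  adj_sym : symmetric adj;
  adj_irrefl : irreflexive adj
}.

Definition same_edge (T : Type) (x y z w : T) : Prop :=
  (x = z /\ y = w) \/ (x = w /\ y = z).

(* [inl a] is v_(a+1) and [inr a] is u_(a+1); the local names i, j are the
   1-based indices. Each edge is listed here in one direction only. *)
Definition H_list (k : nat) (x y : 'I_(2 * k) + 'I_k) : bool :=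
  match x, y with
  | inl a, inl b =>
      let i := a.+1 in let j := b.+1 in
      (j == i.+1) || ((i == 2 * k)%N && (j == 1%N))
  | inr a, inl b =>
      let i := a.+1 in let j := b.+1 in
      [|| (j == 2 * i)%N,
          (i <= k - 2)%N && (j == 2 * i + 3)%N,
          (i == k - 1)%N && (j == 1%N)
        | (i == k) && (j == 3)]
  | _, _ => false
  end.

Definition H_adj (k : nat) : rel ('I_(2 * k) + 'I_k) :=
  fun x y => H_list x y || H_list y x.

Lemma H_adj_sym k : symmetric (@H_adj k).
Proof. by move=> x y; rewrite /H_adj orbC. Qed.

Lemma H_adj_irrefl k : irreflexive (@H_adj k).
Proof.
move=> [a|a]; rewrite /H_adj orbb //=.
rewrite -[X in X || _]negbK neq_ltn ltnS leqnn /=.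
apply/negP => /andP[/eqP e /eqP a1].
by move: e; rewrite a1 => /(congr1 odd); rewrite oddM.
Qed.

Definition H (k : nat) : sgraph := SGraph (@H_adj_sym k) (@H_adj_irrefl k).

Notation plane R := (R^o * R^o)%type.

Definition convex_hull (R : realType) (X : set (plane R)) : set (plane R) :=
  smallest (@convex_set R (plane R : lmodType R)) X.

(* The vertices of a convex polygon are its extreme points. *)
Definition is_vertex (R : realType) (C : set (plane R)) (p : plane R) : Prop :=
  C p /\
  forall (a b : plane R) (t : R), C a -> C b -> 0 < t < 1 ->
    p = t *: a + (1 - t) *: b -> a = p /\ b = p.

Definition strictly_convex (R : realType) (X : set (plane R)) : Prop :=
  finite_set X /\ forall p, X p -> is_vertex (convex_hull X) p.

Definition midpoint (R : realType) (a b : plane R) : plane R :=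
  2^-1 *: (a + b).

Record drawing (R : realType) (G : sgraph) (f : G -> plane R) : Prop :=
    Drawing {
  drawing_vertex : injective f;
  drawing_midpoint : forall x y z w : G, adj x y -> adj z w ->
    midpoint (f x) (f y) = midpoint (f z) (f w) -> same_edge x y z w;
  drawing_vertex_midpoint : forall x y z : G, adj x y ->
    midpoint (f x) (f y) <> f z
}.

Definition midpoints (R : realType) (G : sgraph) (f : G -> plane R) :
    set (plane R) :=
  [set p | exists x y : G, adj x y /\ p = midpoint (f x) (f y)].

Definition Gss (R : realType) (G : sgraph) : Prop :=
  exists f : G -> plane R,
    [/\ drawing f, strictly_convex (range f) & strictly_convex (midpoints f)].

(* Planarity is topological: edges are arbitrary simple arcs, parametrized by
   [0, 1]. An edge is seen in both orientations, [arc y x] being the reverse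
   of [arc x y]. *)
Record plane_embedding (R : realType) (G : sgraph) (f : G -> plane R)
    (arc : G -> G -> R -> plane R) : Prop := PlaneEmbedding {
  emb_vertex : injective f;
  emb_continuous : forall x y, adj x y ->
    {within `[0, 1], continuous (arc x y)};
  emb_simple : forall x y, adj x y -> {in `[0, 1] &, injective (arc x y)};
  emb_source : forall x y, adj x y -> arc x y 0 = f x;
  emb_target : forall x y, adj x y -> arc x y 1 = f y;
  emb_reverse : forall x y (t : R), adj x y -> t \in `[0, 1] ->
    arc y x t = arc x y (1 - t);
  emb_avoid : forall x y z (t : R), adj x y -> t \in `]0, 1[ ->
    arc x y t <> f z;
  emb_disjoint : forall x y z w (s t : R), adj x y -> adj z w ->
    ~ same_edge x y z w -> s \in `]0, 1[ -> t \in `]0, 1[ ->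
    arc x y s <> arc z w t
}.

Definition planar (R : realType) (G : sgraph) : Prop :=
  exists f : G -> plane R, exists arc : G -> G -> R -> plane R,
    plane_embedding f arc.

(* Main.v *)
Require Import Defs.
From HB Require Import structures.
From mathcomp Require Import all_boot all_order all_algebra.
From mathcomp Require Import all_classical all_reals all_analysis.
From Stdlib Require Import Ring.
From mathcomp Require Import lra zify.

Set Implicit Arguments.
Unset Strict Implicit.
Unset Printing Implicit Defensive.

Import Order.TTheory GRing.Theory Num.Theory.
Import numFieldNormedType.Exports.

Local Open Scope classical_set_scope.
Local Open Scope ring_scope.

(** Drawing. In a strictly convex polygon e_0, ..., e_(k-1) put v_(2j+1) and
    v_(2j+2) on the sides at e_j, at a quarter of their length, and u_j close to
    e_j. In the affine coordinates (X, Y) in which e_j is the origin and its two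
    neighbours are the unit points, the other corners satisfy X, Y >= 0 and
    X + Y >= 1, so an explicit linear form strictly separates each vertex and each
    midpoint from the others. For k = 2, where the polygon degenerates, six
    explicit points work. An isolated vertex is added by duplicating an exposed
    point along the kernel of a form exposing it.

    Non-planarity. H_3 is a subdivision of K_{3,3}. Let h(p) say that p is
    lexicographically positive and S(v, e), for a sampling of the arc e, be the
    parity of the number of times e - v crosses the positive first axis. For
    vertex-disjoint arcs e = xx' and f = yy', the differences f(t) - e(s) avoid 0,
    so on a fine grid the crossing parity of the boundary of the square vanishes;
    since crossings of the two half axes add up to sign changes of h, modulo 2
      S(x,f) + S(x',f) + S(y,e) + S(y',e) = h(x-y) + h(x'-y) + h(x-y') + h(x'-y').
    Over all pairs of disjoint edges of K_{3,3} the left-hand sides cancel, whereas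
    h(-p) = 1 - h(p) makes the right-hand sides add up to 1. *)

(** * Crossing parities of plane arcs *)

Definition dot (R : realType) (c p : plane R) : R := c.1 * p.1 + c.2 * p.2.

Definition axes (R : realType) : set (plane R) :=
  [set c | [\/ c = (1, 0), c = (-1, 0), c = (0, 1) | c = (0, -1)]].

Lemma dot_continuous (R : realType) (c : plane R) : continuous (dot c : plane R -> R^o).
Proof.
move=> p; rewrite /dot; apply: cvgD; apply: cvgM; try exact: cvg_cst.
- exact: cvg_fst.
- exact: cvg_snd.
Qed.

Lemma axis_exists (R : realType) (p : plane R) :
  p <> 0 -> exists2 c, axes c & 0 < dot c p.
Proof.
case: p => x y pN0; rewrite /dot.
have [x0|x0|x0] := ltgtP 0 x; rewrite /axes /=.
- by exists (1, 0) => /=; [constructor | lra].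
- by exists (-1, 0) => /=; [constructor | lra].
have [y0|y0|y0] := ltgtP 0 y.
- by exists (0, 1) => /=; [constructor | lra].
- by exists (0, -1) => /=; [constructor | lra].
by case: pN0; rewrite -x0 -y0.
Qed.

Lemma within_dist (R : realType) (g : R -> plane R) (c : plane R) (s e : R) :
  {within `[0, 1], continuous g} -> s \in `[0, 1] -> 0 < e ->
  exists2 r, 0 < r & forall s', s' \in `[0, 1] -> `|s - s'| < r ->
    `|dot c (g s) - dot c (g s')| < e.
Proof.
move=> /subspace_continuousP cg s01 e0.
have /cg gs : [set` `[0, 1]] s by [].
have : (dot c \o g) x @[x --> within [set` `[0, 1]] (nbhs s)] --> (dot c (g s) : R^o).
  exact: (cvg_comp _ _ gs (@dot_continuous _ c (g s))).
move=> /cvgrPdist_lt /(_ _ e0).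
rewrite near_withinE => /nbhs_ballP [r /= r0 br].
by exists r => // s' s'01 ss'; exact: br.
Qed.

(** Compactness of the parameter square: near each pair some coordinate of [d t - g s] keeps its
    sign by continuity, and compactness makes the mesh uniform. *)
Lemma half_plane_cells (R : realType) (g d : R -> plane R) :
  {within `[0, 1], continuous g} -> {within `[0, 1], continuous d} ->
  (forall s t, s \in `[0, 1] -> t \in `[0, 1] -> g s <> d t) ->
  \forall N \near \oo, forall s t, s \in `[0, 1] -> t \in `[0, 1] ->
    exists2 c, axes c & forall s' t', s' \in `[0, 1] -> t' \in `[0, 1] ->
      `|s - s'| <= N.+1%:R^-1 -> `|t - t'| <= N.+1%:R^-1 ->
      0 < dot c (d t' - g s').
Proof.
move=> cg cd gd.
pose P (N : nat) (st : R * R) :=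
  exists2 c, axes c & forall s' t', s' \in `[0, 1] -> t' \in `[0, 1] ->
      `|st.1 - s'| <= N.+1%:R^-1 -> `|st.2 - t'| <= N.+1%:R^-1 ->
      0 < dot c (d t' - g s').
have /compact_near_coveringP/(_ nat \oo P _) K :=
  compact_setX (@segment_compact R 0 1) (@segment_compact R 0 1).
apply: (filterS _ (K _)) => [N PN s t s01 t01|[s t] [/= s01 t01]].
  exact: (PN (s, t)).
have [|c axc c0] := @axis_exists _ (d t - g s).
  by move/subr0_eq => dg; apply: (gd s t).
have D0 : 0 < dot c (d t - g s) / 2 by rewrite divr_gt0.
have [r1 r10 h1] := within_dist c cg s01 D0.
have [r2 r20 h2] := within_dist c cd t01 D0.
pose r := Num.min r1 r2.
have r0 : 0 < r by rewrite lt_min r10 r20.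
have /andP[rr1 rr2] : (r <= r1) && (r <= r2) by rewrite -le_min.
(* One half of [r] is for the distance to the centre, the other for the mesh. *)
exists (ball (s, t) (r / 2), [set N | N.+1%:R^-1 < r / 2]) => /=.
  split; first by apply: nbhsx_ballx; rewrite divr_gt0.
  by have := near_infty_natSinv_lt (PosNum (divr_gt0 r0 (ltr0n R 2))).
move=> [[s1 t1] N] /= [[b1 b2] rN].
have {}rN : N.+1%:R^-1 < r / 2 := rN.
exists c => // s' t' s'01 t'01 /= xs xt.
have tri (x y z : R) : `|x - y| < r / 2 -> `|y - z| < r / 2 -> `|x - z| < r.
  move=> xy yz; rewrite (splitr r); apply: le_lt_trans (ler_distD y x z) _.
  exact: ltrD.
have := h1 _ s'01 (lt_le_trans (tri _ _ _ b1 (le_lt_trans xs rN)) rr1).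
have := h2 _ t'01 (lt_le_trans (tri _ _ _ b2 (le_lt_trans xt rN)) rr2).
move: c0; rewrite !ltr_norml /dot /=; lra.
Qed.

Definition lexpos (R : realType) (p : plane R) : bool :=
  (0 < p.2) || (p.2 == 0) && (0 < p.1).

(* For points of a common half plane bounded by a coordinate axis, whether the
   segment from [p] to [q] crosses the positive first axis. *)
Definition cross_axis (R : realType) (p q : plane R) : bool :=
  (lexpos p (+) lexpos q) && (0 < p.1).

Lemma lexposN (R : realType) (p : plane R) :
  p <> 0 -> lexpos (- p) = ~~ lexpos p.
Proof.
case: p => x y pN0; rewrite /lexpos /= !oppr_gt0 oppr_eq0.
case: ltgtP => //= y0; case: ltgtP => //= x0.
by case: pN0; rewrite x0 y0.
Qed.

Lemma axesN (R : realType) (c : plane R) : axes c -> axes (- c).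
Proof.
have oppE (x y : R) : - ((x, y) : plane R) = (- x, - y) by [].
by case=> ->; rewrite oppE ?oppr0 ?opprK;
  [constructor 2 | constructor 1 | constructor 4 | constructor 3].
Qed.

(** For [c = (1, 0)], [cross_axis] is the difference of the values of [lexpos]; for the other three
    forms it vanishes. Either way its sum along a path depends only on the ends. *)
Lemma cross_axis_cell (R : realType) (c p q r s : plane R) : axes c ->
  0 < dot c p -> 0 < dot c q -> 0 < dot c r -> 0 < dot c s ->
  cross_axis p q (+) cross_axis q s = cross_axis p r (+) cross_axis r s.
Proof.
case: p q r s => p1 p2 [q1 q2] [r1 r2] [s1 s2] axc.
rewrite /dot /cross_axis /=; case: axc => -> /=;
  rewrite ?(mul1r, mul0r, mulN1r, addr0, add0r, oppr_gt0) => p0 q0 r0 s0.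
- rewrite p0 q0 r0 !andbT; by do 4 case: lexpos.
- by rewrite (lt_gtF p0) (lt_gtF q0) (lt_gtF r0) !andbF.
- by rewrite /lexpos /= p0 q0 r0 s0.
- by rewrite /lexpos /= (lt_gtF p0) (lt_gtF q0) (lt_gtF r0) (lt_gtF s0)
    !(lt_eqF p0, lt_eqF q0, lt_eqF r0, lt_eqF s0).
Qed.

(** Negation exchanges crossings of the positive and the negative half axis; together these are the
    changes of [lexpos]. *)
Lemma cross_axisN (R : realType) (c p q : plane R) : axes c ->
  0 < dot c p -> 0 < dot c q ->
  cross_axis (- p) (- q) = cross_axis p q (+) (lexpos p (+) lexpos q).
Proof.
move=> axc p0 q0.
have N0 z : 0 < dot c z -> z <> 0.
  by move=> z0 zE; move: z0; rewrite zE /dot /= !mulr0 addr0 ltxx.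
rewrite /cross_axis !lexposN; try exact: N0.
rewrite addNb addbN negbK /= oppr_gt0.
case: p q p0 q0 {N0} => p1 p2 [q1 q2]; rewrite /dot /=.
case: axc => -> /=;
  rewrite ?(mul1r, mul0r, mulN1r, addr0, add0r, oppr_gt0) => p0 q0.
- by rewrite p0 (lt_gtF p0) andbF andbT addbb.
- by rewrite p0 (lt_gtF p0) andbF andbT.
- by rewrite /lexpos /= p0 q0.
- by rewrite /lexpos /= (lt_gtF p0) (lt_gtF q0) (lt_eqF p0) (lt_eqF q0).
Qed.

Lemma addb_telescope (c : nat -> bool) n :
  \big[addb/false]_(i < n) (c i (+) c i.+1) = c 0%N (+) c n.
Proof.
elim: n => [|n IH]; first by rewrite big_ord0 addbb.
by rewrite big_ord_recr /= IH addbA -[_ (+) _ (+) c n]addbA addbb addbF.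
Qed.

(** Discrete Green formula: [row i j] is the grid edge from (i, j) to (i, j+1), [col i j] the one
    from (i, j) to (i+1, j), and interior edges cancel. *)
Lemma addb_grid (row col : nat -> nat -> bool) m n :
  (forall i j, (i < m)%N -> (j < n)%N ->
    row i j (+) col i j.+1 = col i j (+) row i.+1 j) ->
  \big[addb/false]_(j < n) row 0%N j (+) \big[addb/false]_(j < n) row m j =
  \big[addb/false]_(i < m) col i 0%N (+) \big[addb/false]_(i < m) col i n.
Proof.
elim: m => [|m IH] H; first by rewrite !big_ord0 addbb.
have step : \big[addb/false]_(j < n) row m j (+) \big[addb/false]_(j < n) row m.+1 j
    = col m 0%N (+) col m n.
  rewrite -big_split -addb_telescope; apply: eq_bigr => j _ /=.
  have := H m j (ltnSn m) (ltn_ord j).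
  by case: (row m j); case: (row m.+1 j); case: (col m j); case: (col m j.+1).
rewrite !big_ord_recr /= addbACA -IH; last by move=> i j im; apply: H; exact: ltnW.
rewrite -step; move: (\big[_/_]_(j < n) row 0%N j) (\big[_/_]_(j < n) row m j).
by case; case; case: (\big[_/_]_(_ < _) _).
Qed.

Definition crossings (R : realType) n (g : nat -> plane R) (v : plane R) :=
  \big[addb/false]_(i < n) cross_axis (g i - v) (g i.+1 - v).

(* Summing the cocycle identity [cross_axis_cell] over the grid of differences
   [d j - g i] leaves only the boundary of the grid. *)
Lemma crossings_parity (R : realType) n (g d : nat -> plane R) :
  (forall i j, (i < n)%N -> (j < n)%N -> exists2 c, axes c &
    forall i' j', (i <= i' <= i.+1)%N -> (j <= j' <= j.+1)%N ->
      0 < dot c (d j' - g i')) ->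
  (crossings n d (g 0) (+) crossings n d (g n)) (+)
  (crossings n g (d 0) (+) crossings n g (d n)) =
  (lexpos (g 0 - d 0) (+) lexpos (g n - d 0)) (+)
  (lexpos (g 0 - d n) (+) lexpos (g n - d n)).
Proof.
move=> H.
(* On these two sides the differences are [-(g i - d j)], and the changes of [lexpos] produced by
   [cross_axisN] telescope. *)
have flip j : (j = 0 \/ j = n)%N ->
    \big[addb/false]_(i < n) cross_axis (d j - g i) (d j - g i.+1) =
    crossings n g (d j) (+) (lexpos (g 0 - d j) (+) lexpos (g n - d j)).
  move=> jE; rewrite -(addb_telescope (fun i => lexpos (g i - d j))) -big_split.
  apply: eq_bigr => i _.
  have [c axc c0] : exists2 c, axes c & forall i', (i <= i' <= i.+1)%N ->
      0 < dot c (d j - g i').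
    case: jE => jE; subst j.
      have n0 : (0 < n)%N by apply: leq_ltn_trans (ltn_ord i).
      have [c axc c0] := H i 0%N (ltn_ord i) n0.
      by exists c => // i' ii'; apply: c0.
    (* The side [j = n] borders the cells of index [n.-1]. *)
    have n0 : (0 < n)%N by apply: leq_ltn_trans (ltn_ord i).
    have n1 : (n.-1 < n)%N by rewrite prednK.
    have [c axc c0] := H i n.-1 (ltn_ord i) n1.
    by exists c => // i' ii'; apply: c0; rewrite // prednK // leqnn leq_pred.
  pose c' : plane R := - c.
  have axc' : axes c' by apply: axesN.
  have c'0 i' : (i <= i' <= i.+1)%N -> 0 < dot c' (g i' - d j).
    by move=> /c0; rewrite /c' /dot /=; lra.
  rewrite -(opprB (g i)) -(opprB (g i.+1)); apply: cross_axisN axc' _ _;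
    by apply: c'0; rewrite ?leqnn ?leqnSn.
have := @addb_grid (fun i j => cross_axis (d j - g i) (d j.+1 - g i))
  (fun i j => cross_axis (d j - g i) (d j - g i.+1)) n n.
rewrite !flip; [|by right|by left].
move=> ->; last first.
  move=> i j im jn; have [c axc c0] := H i j im jn.
  by apply: (cross_axis_cell axc); apply: c0; rewrite ?leqnn ?leqnSn.
move: (crossings _ _ _) (crossings _ _ _) (lexpos _) (lexpos _) (lexpos _)
  (lexpos _).
by do 6 case.
Qed.

Lemma embedding_arcs_disjoint (R : realType) (G : sgraph) (f : G -> plane R) arc
    (x x' y y' : G) (s t : R) :
  plane_embedding f arc -> adj x x' -> adj y y' -> uniq [:: x; x'; y; y'] ->
  s \in `[0, 1] -> t \in `[0, 1] -> arc x x' s <> arc y y' t.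
Proof.
move=> [finj _ _ src tgt _ avoid disj] xx' yy'.
rewrite /= !inE !negb_or -!andbA => /and5P[_ xy xy' x'y /and3P[x'y' _ _]].
have itvE (z : R) : z \in `[0, 1] -> [\/ z = 0, z = 1 | z \in `]0, 1[].
  rewrite !in_itv /= !le_eqVlt => /andP[/orP[/eqP <-|z0] /orP[/eqP ->|z1]];
    by [constructor 1 | constructor 2 | constructor 3; rewrite z0 z1].
have fN a b : a != b -> f a <> f b by move=> + /finj ab; rewrite ab eqxx.
move=> /itvE[->|->|s01] /itvE[->|->|t01];
  rewrite ?(src _ _ xx', src _ _ yy', tgt _ _ xx', tgt _ _ yy'); try exact: fN.
- by move/esym; apply: avoid.
- by move/esym; apply: avoid.
- exact: avoid.
- exact: avoid.
apply: disj => //; case=> -[]; first by move=> E; rewrite E eqxx in xy.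
by move=> E; rewrite E eqxx in xy'.
Qed.

Definition sample (R : realType) n (g : R -> plane R) (i : nat) : plane R :=
  g (i%:R / n%:R).

(** Holding for all large [N], the identity can be used with one [N] for finitely many pairs of
    edges. *)
Lemma edge_crossings_parity (R : realType) (G : sgraph) (f : G -> plane R) arc
    (x x' y y' : G) :
  plane_embedding f arc -> adj x x' -> adj y y' -> uniq [:: x; x'; y; y'] ->
  \forall N \near \oo,
  let S v a b := crossings N.+1 (sample N.+1 (arc a b)) (f v) in
  let gt a b := lexpos (f a - f b) in
  (S x y y' (+) S x' y y') (+) (S y x x' (+) S y' x x') =
  (gt x y (+) gt x' y) (+) (gt x y' (+) gt x' y').
Proof.
move=> emb xx' yy' U.
have cx := emb_continuous emb xx'; have cy := emb_continuous emb yy'.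
apply: (filterS _ (half_plane_cells cx cy _)); last first.
  by move=> s t s01 t01; exact: (embedding_arcs_disjoint emb xx' yy' U s01 t01).
move=> N H.
have N0 : N.+1%:R != 0 :> R by rewrite pnatr_eq0.
have smp0 a b : adj a b -> sample N.+1 (arc a b) 0%N = f a.
  by move=> ab; rewrite /sample mul0r; exact: (emb_source emb ab).
have smp1 a b : adj a b -> sample N.+1 (arc a b) N.+1 = f b.
  by move=> ab; rewrite /sample mulfV //; exact: (emb_target emb ab).
have := @crossings_parity R N.+1 (sample N.+1 (arc x x')) (sample N.+1 (arc y y')).
rewrite !smp0 // !smp1 //; apply => i j iN jN.
have in01 (m : nat) : (m <= N.+1)%N -> m%:R / N.+1%:R \in `[0 : R, 1].
  move=> mN; rewrite in_itv /= divr_ge0 ?ler0n //=.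
  by rewrite ler_pdivrMr ?ltr0n // mul1r ler_nat.
have close (m m' : nat) : (m <= m' <= m.+1)%N ->
    `|m%:R / N.+1%:R - m'%:R / N.+1%:R| <= N.+1%:R^-1 :> R.
  move=> mm'; rewrite -mulrBl normrM (ger0_norm (x := _^-1)) ?invr_ge0 ?ler0n //.
  rewrite ler_piMl ?invr_ge0 ?ler0n //.
  have /orP[/eqP->|/eqP->] : (m' == m) || (m' == m.+1) by lia.
    by rewrite subrr normr0 ler01.
  by rewrite -natr1 opprD addNKr normrN normr1.
have [c axc c0] := H _ _ (in01 i (ltnW iN)) (in01 j (ltnW jN)).
exists c => // i' j' ii' jj'; apply: c0.
- by apply: in01; lia.
- by apply: in01; lia.
- exact: close.
- exact: close.
Qed.

(** * Non-planarity of H_3 *)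

(** Prepares for the [ring] of Stdlib, which knows the Boolean ring with addition [xorb]. *)
Lemma addb_xorb (a b : bool) : a (+) b = xorb a b.
Proof. by case: a; case: b. Qed.

(* [H 3] is K_{3,3}, seen as the hexagon 0,...,5 with its long diagonals, which
   are subdivided by the vertices 6, 7, 8. *)
Definition H3_vertex (i : nat) : H 3 :=
  if (i < 6)%N then inl (@inZp 5 i) else inr (@inZp 2 i).

Definition K33_paths : seq (seq nat) :=
  [:: [:: 0; 1]; [:: 1; 2]; [:: 2; 3]; [:: 3; 4]; [:: 4; 5]; [:: 5; 0];
      [:: 1; 6; 4]; [:: 0; 7; 3]; [:: 2; 8; 5]]%N.

(* Every pair of vertex-disjoint edges of K_{3,3} is listed once: disjoint paths
   have distinct heads. *)
Definition K33_disjoint_edges : seq ((nat * nat) * (nat * nat)) :=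
  flatten [seq [seq (e, e') | e <- zip pq.1 (behead pq.1),
                              e' <- zip pq.2 (behead pq.2)] |
    pq <- [seq pq <- [seq (p, q) | p <- K33_paths, q <- K33_paths] |
      (head 0 pq.1 < head 0 pq.2)%N && ~~ has (mem pq.1) pq.2]].

Lemma K33_disjoint_edgesP p : p \in K33_disjoint_edges ->
  [&& adj (H3_vertex p.1.1) (H3_vertex p.1.2),
      adj (H3_vertex p.2.1) (H3_vertex p.2.2) &
      uniq [seq H3_vertex i | i <- [:: p.1.1; p.1.2; p.2.1; p.2.2]]].
Proof. by move: p; apply/allP; vm_compute. Qed.

(** Sum of the two sides of [edge_crossings_parity], hence false for an embedding. *)
Definition parity_defect (S : nat -> nat -> nat -> bool) (gt : nat -> nat -> bool)
    (p : (nat * nat) * (nat * nat)) : bool :=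
  let: ((x, x'), (y, y')) := p in
  ((S x y y' (+) S x' y y') (+) (S y x x' (+) S y' x x')) (+)
  ((gt x y (+) gt x' y) (+) (gt x y' (+) gt x' y')).

(** Each [S v a b] occurs an even number of times: a hexagon vertex off an edge of K_{3,3} lies on
    two edges disjoint from it, and a subdividing vertex lies on two pieces of its path. The terms
    [g a b] cancel too, but the number of negations is odd. *)
Lemma K33_parity_defect (S : nat -> nat -> nat -> bool) (g : nat -> nat -> bool) :
  \big[addb/false]_(p <- K33_disjoint_edges)
    parity_defect S (fun a b => if (a < b)%N then g a b else ~~ g b a) p = true.
Proof.
have negE b : ~~ b = xorb true b by [].
have -> : K33_disjoint_edges =
    ltac:(let l := eval vm_compute in K33_disjoint_edges in exact l).
  by vm_compute.
rewrite !big_cons big_nil /parity_defect /= !negE !addb_xorb.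
ring.
Qed.

Lemma H3_not_planar (R : realType) : ~ planar R (H 3).
Proof.
move=> [f [arc emb]].
pose S N v a b := crossings N.+1
  (sample N.+1 (arc (H3_vertex a) (H3_vertex b))) (f (H3_vertex v)).
pose g a b := lexpos (f (H3_vertex a) - f (H3_vertex b)).
pose gt a b := if (a < b)%N then g a b else ~~ g b a.
have gtE a b : H3_vertex a != H3_vertex b -> g a b = gt a b.
  rewrite /gt; case: ltnP => // _ ab; rewrite /g -opprB lexposN //.
  by move=> /subr0_eq/(emb_vertex emb) ba; rewrite ba eqxx in ab.
have : \forall N \near \oo, forall p : seq_sub K33_disjoint_edges,
    parity_defect (S N) gt (val p) = false.
  apply: filter_forall => -[[[x x'] [y y']] /= /K33_disjoint_edgesP].
  move=> /and3P[/= xx' yy' U].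
  apply: filterS (edge_crossings_parity emb xx' yy' U) => N /=.
  move: U; rewrite /= !inE !negb_or -!andbA => /and5P[_ xy xy' x'y /and3P[x'y' _ _]].
  by rewrite -!gtE // => ->; exact: addbb.
move=> /filter_ex[N H]; have := K33_parity_defect (S N) g.
by rewrite big1_seq // => p /andP[_ pK]; exact: (H (SeqSub pK)).
Qed.

From mathcomp Require Import ring.

(** * Exposed drawings *)

Lemma dotD (R : realType) (c p q : plane R) : dot c (p + q) = dot c p + dot c q.
Proof. by rewrite /dot /=; lra. Qed.

Lemma dotZ (R : realType) (c p : plane R) a : dot c (a *: p) = a * dot c p.
Proof. by rewrite /dot /= /GRing.scale /=; lra. Qed.

(** The open half plane below [p], together with [p], is convex and contains [X], hence the hull;
    there [p] is the only maximum of the form. *)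
Lemma exposed_is_vertex (R : realType) (X : set (plane R)) (c p : plane R) :
  X p -> (forall q, X q -> q <> p -> dot c q < dot c p) ->
  is_vertex (convex_hull X) p.
Proof.
move=> Xp cp; pose C : set (plane R) := [set q | q = p \/ dot c q < dot c p].
have convC : @convex_set R (plane R : lmodType R) C.
  apply/convex_setW => x y; rewrite !inE => Cx Cy k k0 k1; rewrite inE.
  have dotE : dot c (conv k x y) = k%:num * dot c x + (1 - k%:num) * dot c y.
    by rewrite /conv /= dotD !dotZ.
  case: Cx => [xp|xp].
    case: Cy => [yp|yp]; first by left; rewrite xp yp convmm.
    right; rewrite dotE xp; nra.
  by right; rewrite dotE; case: Cy => [->|yp]; nra.
have hullC : convex_hull X `<=` C.
  apply: smallest_sub => // q Xq.
  by have [->|/eqP qp] := eqVneq q p; [left|right; apply: cp].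
split=> [|a b t /hullC Ca /hullC Cb /andP[t0 t1] pE].
  exact: sub_gen_smallest.
have dotE : dot c p = t * dot c a + (1 - t) * dot c b.
  by rewrite [in LHS]pE dotD !dotZ.
case: Ca Cb => [ap|ap] [bp|bp] //; exfalso; move: dotE; rewrite ?ap ?bp; nra.
Qed.

(** Exposing forms yield strict convexity and all distinctness conditions at once, and survive small
    perturbations. Sums replace midpoints to avoid the factor 1/2. *)
Record exposed_drawing (R : realType) (G : sgraph) (f : G -> plane R) : Prop :=
    ExposedDrawing {
  exposed_vertex : forall x, exists c, forall y, y <> x ->
    dot c (f y) < dot c (f x);
  exposed_midpoint : forall x y, adj x y -> exists c, forall z w, adj z w ->
    same_edge x y z w \/ dot c (f z + f w) < dot c (f x + f y)
}.

Lemma dot_midpoint (R : realType) (c p q : plane R) :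
  dot c (midpoint p q) = dot c (p + q) / 2.
Proof. by rewrite /midpoint dotZ mulrC. Qed.

Lemma same_edge_midpoint (R : realType) (G : sgraph) (f : G -> plane R) x y z w :
  same_edge x y z w -> midpoint (f x) (f y) = midpoint (f z) (f w).
Proof. by case=> -[-> ->] //; rewrite /midpoint addrC. Qed.

Lemma adj_neq (G : sgraph) (x y : G) : adj x y -> x <> y.
Proof. by move=> + xy; rewrite xy adj_irrefl. Qed.

Lemma exposed_drawing_Gss (R : realType) (G : sgraph) (f : G -> plane R) :
  exposed_drawing f -> Gss R G.
Proof.
move=> [expv expm]; exists f; split.
- split=> [x y fxy|x y z w xy zw mE|x y z xy mE].
  + apply: contrapT => /nesym yx; have [c /(_ y yx)] := expv x.
    by rewrite fxy ltxx.
  + have [c /(_ z w zw)[//|]] := expm x y xy.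
    have := dot_midpoint c (f x) (f y); rewrite mE dot_midpoint; lra.
  (* The form exposing [z] is smaller at a midpoint, since the two ends are not both [z]. *)
  + have [c cz] := expv z.
    have := dot_midpoint c (f x) (f y); rewrite mE dotD.
    have [xz|/eqP/cz] := eqVneq x z; have [yz|/eqP/cz] := eqVneq y z.
    * by case: (adj_neq xy); rewrite xz yz.
    * rewrite xz; lra.
    * rewrite yz; lra.
    * lra.
- split; first exact: finite_image.
  move=> _ [x _ <-]; have [c cx] := expv x.
  apply: (@exposed_is_vertex _ _ c); first by exists x.
  move=> _ [y _ <-] fyx; apply: cx => yx; by case: fyx; rewrite yx.
split.
  apply: (@sub_finite_set _ _ ((fun p : G * G => midpoint (f p.1) (f p.2)) @` setT)).
    by move=> _ [x [y [xy ->]]]; exists (x, y).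
  exact: finite_image.
move=> _ [x [y [xy ->]]]; have [c cxy] := expm x y xy.
apply: (@exposed_is_vertex _ _ c); first by exists x, y.
move=> _ [z [w [zw ->]]] mE; have [/same_edge_midpoint|] := cxy z w zw.
  by move=> /(_ _ f)/esym.
rewrite !dot_midpoint; lra.
Qed.

(** * Adding isolated vertices *)

Definition add_isolated_adj (G : sgraph) : rel (option G) :=
  fun x y => if x is Some a then if y is Some b then adj a b else false else false.

Lemma add_isolated_sym (G : sgraph) : symmetric (@add_isolated_adj G).
Proof. by move=> [x|] [y|] //=; rewrite adj_sym. Qed.

Lemma add_isolated_irrefl (G : sgraph) : irreflexive (@add_isolated_adj G).
Proof. by move=> [x|] //=; rewrite adj_irrefl. Qed.

Definition add_isolated (G : sgraph) : sgraph :=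
  SGraph (@add_isolated_sym G) (@add_isolated_irrefl G).

Lemma planar_add_isolated (R : realType) (G : sgraph) :
  planar R (add_isolated G) -> planar R G.
Proof.
move=> [f [arc [finj cont simple src tgt rev avoid disj]]].
exists (f \o Some), (fun x y => arc (Some x) (Some y)); split.
- by move=> x y /finj[].
- by move=> x y; apply: (cont (Some x) (Some y)).
- by move=> x y; apply: (simple (Some x) (Some y)).
- by move=> x y; apply: (src (Some x) (Some y)).
- by move=> x y; apply: (tgt (Some x) (Some y)).
- by move=> x y t; apply: (rev (Some x) (Some y)).
- by move=> x y z t; apply: (avoid (Some x) (Some y)).
- move=> x y z w s t xy zw E; apply: (disj (Some x) (Some y) (Some z) (Some w)) => //.
  by case=> -[[xz] [yw]]; apply: E; [left | right].
Qed.

(** Finitely many strict inequalities true at [e = 0] persist for small positive [e]. *)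
Lemma small_factor (R : realType) (I : finType) (P : set I) (a b : I -> R) :
  (forall i, P i -> 0 < a i) ->
  exists2 e, 0 < e & forall i, P i -> e * b i < a i.
Proof.
move=> a0.
have small : \forall e \near 0^'+, forall i, P i -> e * b i < a i.
  apply: filter_forall => i.
  have [/a0 ai0|nPi] := pselect (P i); last by near=> e.
  have : e * b i @[e --> 0^'+] --> (0 * b i : R^o).
    by apply: cvgM; [exact: cvg_at_right_filter (@cvg_id _ _) | exact: cvg_cst].
  rewrite mul0r => /cvgr_lt/(_ _ ai0); apply: filterS => e eb _; exact: eb.
by have [e [e0 eP]] := filter_ex (filterI (nbhs_right_gt 0) small); exists e.
Unshelve. all: by end_near. Qed.

(* The new point [f p + e *: d] is a copy of [f p] pushed along the direction
   [d] on which the form [c] exposing [f p] vanishes; both points are then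
   exposed by perturbing [c] to [c + k *: d] and [c - k *: d]. *)
Lemma exposed_add_isolated (R : realType) (G : sgraph) (f : G -> plane R) (p : G) :
  exposed_drawing f -> exists f' : add_isolated G -> plane R, exposed_drawing f'.
Proof.
move=> [expv expm].
have [c cp] := expv p.
(* If [c] is zero, [p] is the only vertex and any nonzero direction will do. *)
pose d : plane R := if (c.1 == 0) && (c.2 == 0) then (1, 0) else (- c.2, c.1).
have cd : dot c d = 0.
  rewrite /dot /d; case: ifP => [/andP[/eqP-> /eqP->]|_] /=; lra.
have dd : 0 < dot d d.
  rewrite /dot /d; case: ifP => [_|] /=; first lra.
  case: (ltgtP c.1 0) => //=; case: (ltgtP c.2 0) => //= *; nra.
have /choice[g gP] := expv.
(* The push is so small that every other vertex stays exposed by its own form. *)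
have [e e0 eP] : exists2 e, 0 < e & forall x, x <> p ->
    e * dot (g x) d < dot (g x) (f x) - dot (g x) (f p).
  by apply: small_factor => x /nesym/gP; rewrite subr_gt0.
have [k k0 kP] : exists2 k, 0 < k & forall x, x <> p ->
    k * `|dot d (f x) - dot d (f p)| < dot c (f p) - dot c (f x).
  by apply: small_factor => x /cp; rewrite subr_gt0.
pose f' (x : add_isolated G) := if x is Some a then f a else f p + e *: d.
have dotl a (u v w : plane R) : dot (u + a *: v) w = dot u w + a * dot v w.
  by rewrite /dot /= /GRing.scale /=; lra.
have kedd : 0 < k * (e * dot d d) by rewrite !mulr_gt0.
exists f'; split.
- move=> [x|].
  + have [->|/eqP xp] := eqVneq x p.
      exists (c + (- k) *: d) => -[y|] yp; rewrite /= !dotl ?dotD ?dotZ.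
        have := kP y; have /[swap]/[apply] : y <> p by move=> E; apply: yp; rewrite E.
        have := ler_norm (dot d (f p) - dot d (f y)); rewrite distrC; nra.
      rewrite cd; lra.
    exists (g x) => -[y|] yx /=; first by apply: gP => E; apply: yx; rewrite E.
    rewrite dotD dotZ; have := eP x xp; lra.
  + exists (c + k *: d) => -[y|] yp //; rewrite /= !dotl !dotD !dotZ cd.
    have [->|/eqP/kP] := eqVneq y p; first lra.
    have := ler_norm (dot d (f y) - dot d (f p)); nra.
- move=> [x|] [y|] //= xy; have [c' c'P] := expm x y xy.
  exists c' => -[z|] [w|] //= zw; have [E|] := c'P z w zw; last by right.
  by left; case: E => -[-> ->]; [left | right].
Qed.

(** * Convex polygons *)

Definition aff (R : realType) (h : plane R * R) (p : plane R) : R :=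
  dot h.1 p + h.2.

(* [a] and [b] are the values at the two neighbours of the corner: the form is
   aX + bY in the affine coordinates X, Y in which [e j], [e (ordS j)] and
   [e (ord_pred j)] are (0, 0), (1, 0) and (0, 1). *)
Record convex_polygon (R : realType) k (e : 'I_k -> plane R) : Prop := ConvexPolygon {
  corner_form : forall j (a b : R), 1 <= a -> 1 <= b -> exists h,
    [/\ aff h (e j) = 0, aff h (e (ordS j)) = a, aff h (e (ord_pred j)) = b &
        forall i, i != j -> 1 <= aff h (e i)];
  side_form : forall j, exists h, [/\ aff h (e j) = 0, aff h (e (ordS j)) = 0 &
        forall i, i != j -> i != ordS j -> 0 < aff h (e i)]
}.

Definition parabola (R : realType) k (i : 'I_k) : plane R := (i%:R, i%:R ^+ 2).

Lemma aff_parabola (R : realType) k (i : 'I_k) (a b d : R) :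
  aff ((b, a), d) (parabola R i) = a * i%:R ^+ 2 + b * i%:R + d.
Proof. by rewrite /aff /dot /=; lra. Qed.

(** Along the parabola an affine form is a polynomial of degree at most 2 in [i], so one vanishing
    at two corners is a multiple of the product of two linear factors. The corners [0] and [k.-1],
    whose neighbours wrap around, are treated apart. *)
Lemma parabola_corner_coordinates (R : realType) k (j : 'I_k) : (2 < k)%N ->
  exists X Y : plane R * R,
  [/\ aff X (parabola R j) = 0 /\ aff Y (parabola R j) = 0,
      aff X (parabola R (ordS j)) = 1 /\ aff Y (parabola R (ordS j)) = 0,
      aff X (parabola R (ord_pred j)) = 0 /\ aff Y (parabola R (ord_pred j)) = 1,
      forall i, i != j -> 0 <= aff X (parabola R i) /\ 0 <= aff Y (parabola R i) /\
        1 <= aff X (parabola R i) + aff Y (parabola R i) &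
      forall i, i != j -> i != ordS j -> 0 < aff Y (parabola R i)].
Proof.
move=> k2; pose m : R := k.-1%:R; pose u : R := j%:R.
have m2 : 2 <= m by rewrite /m (ler_nat R 2); lia.
have le_m (i : 'I_k) : i%:R <= m by rewrite /m ler_nat; have := ltn_ord i; lia.
have ltR (a b : nat) : (a < b)%N -> a%:R + 1 <= b%:R :> R by rewrite natr1 ler_nat.
have neq_val (i l : 'I_k) n : l = n :> nat -> i != l -> (i : nat) != n by move=> <-.
have ge0 (i : 'I_k) : 0 <= i%:R :> R by exact: ler0n.
have [j0|j0] := eqVneq (j : nat) 0%N.
  have Sj : ordS j = 1%N :> nat by rewrite /= j0 modn_small //; lia.
  have Pj : ord_pred j = k.-1 :> nat by rewrite /= j0 add0n modn_small //; lia.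
  have ij (i : 'I_k) : i != j -> 1 <= i%:R :> R.
    by move=> /(neq_val _ _ _ j0); rewrite -lt0n => /ltR; rewrite add0r.
  have P0 : 0 < m * (m - 1) by nra.
  exists ((m / (m - 1), - (m - 1)^-1), 0), ((- (m * (m - 1))^-1, (m * (m - 1))^-1), 0).
  have XE (i : R) : - (m - 1)^-1 * i ^+ 2 + m / (m - 1) * i + 0 = i * (m - i) / (m - 1).
    by field; lra.
  have YE (i : R) : (m * (m - 1))^-1 * i ^+ 2 + (- (m * (m - 1))^-1) * i + 0 =
      i * (i - 1) / (m * (m - 1)) by field; lra.
  split=> [||| i /ij i1| i /ij i1]; rewrite !aff_parabola ?XE ?YE.
  - by rewrite j0 !mul0r.
  - by rewrite Sj; split; [rewrite mul1r divff //; lra | rewrite subrr mulr0 mul0r].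
  - by rewrite Pj -/m; split; [rewrite subrr mulr0 mul0r | rewrite divff //; lra].
  - have im := le_m i.
    split; first by rewrite divr_ge0 // ?mulr_ge0; lra.
    split; first by rewrite divr_ge0 // ?mulr_ge0; lra.
    have -> : i%:R * (m - i%:R) / (m - 1) + i%:R * (i%:R - 1) / (m * (m - 1)) =
      1 + (i%:R - 1) * (m - i%:R) / m by field; lra.
    by rewrite lerDl divr_ge0 // ?mulr_ge0; lra.
  - move=> /(neq_val _ _ _ Sj) i2.
    have {}i1 : (1 < i)%N by move: i1 i2; rewrite (ler_nat R 1); lia.
    have {}i1 := ltR _ _ i1; rewrite mulr1n in i1.
    by rewrite divr_gt0 // mulr_gt0; lra.
have [jm|jm] := eqVneq (j : nat) k.-1.
  have Sj : ordS j = 0%N :> nat by rewrite /= jm prednK ?modnn //; lia.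
  have Pj : ord_pred j = k.-2 :> nat.
    rewrite /= jm (_ : (k.-1 + k).-1 = k.-2 + k)%N; last lia.
    by rewrite modnDr modn_small //; lia.
  have PjR : (ord_pred j : nat)%:R = m - 1 :> R.
    by rewrite Pj /m -[in RHS](prednK (n := k.-1)) -?natr1 ?addrK //; lia.
  have ij (i : 'I_k) : i != j -> i%:R + 1 <= m.
    move=> /(neq_val _ _ _ jm) ij; apply: ltR.
    by have := ltn_ord i; lia.
  have P0 : 0 < m * (m - 1) by nra.
  exists ((- (2 * m - 1) / (m * (m - 1)), (m * (m - 1))^-1), 1),
         ((m / (m - 1), - (m - 1)^-1), 0).
  have YE (i : R) : - (m - 1)^-1 * i ^+ 2 + m / (m - 1) * i + 0 = i * (m - i) / (m - 1).
    by field; lra.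
  have XE (i : R) : (m * (m - 1))^-1 * i ^+ 2 + (- (2 * m - 1) / (m * (m - 1))) * i + 1 =
      (m - i) * (m - 1 - i) / (m * (m - 1)) by field; lra.
  split=> [||| i /ij i1| i /ij i1]; rewrite !aff_parabola ?XE ?YE.
  - by rewrite jm -/m subrr mul0r mulr0 !mul0r.
  - by rewrite Sj subr0 mul0r subr0 mul0r; split=> //; rewrite divff //; lra.
  - by rewrite PjR; split; [rewrite subrr mulr0 mul0r | field; lra].
  - have i0 := ge0 i.
    split; first by rewrite divr_ge0 // ?mulr_ge0; lra.
    split; first by rewrite divr_ge0 // ?mulr_ge0; lra.
    have -> : (m - i%:R) * (m - 1 - i%:R) / (m * (m - 1)) + i%:R * (m - i%:R) / (m - 1) =
      1 + i%:R * (m - 1 - i%:R) / m by field; lra.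
    by rewrite lerDl divr_ge0 // ?mulr_ge0; lra.
  - move=> /(neq_val _ _ _ Sj); rewrite -lt0n => /ltR; rewrite add0r => i2.
    by rewrite divr_gt0 // ?mulr_gt0; lra.
have jk := ltn_ord j.
have Sj : ordS j = j.+1 :> nat by rewrite /= modn_small //; lia.
have Pj : ord_pred j = j.-1 :> nat.
  rewrite /= (_ : (j + k).-1 = j.-1 + k)%N; last lia.
  by rewrite modnDr modn_small //; lia.
have SjR : (ordS j : nat)%:R = u + 1 :> R by rewrite Sj natr1.
have PjR : (ord_pred j : nat)%:R = u - 1 :> R.
  by rewrite Pj /u -[in RHS](prednK (n := j)) -?natr1 ?addrK //; lia.
(* With t = i - u these are X = t(t + 1)/2 and Y = t(t - 1)/2, so X + Y = t^2. *)
exists ((2^-1 - u, 2^-1), (u ^+ 2 - u) / 2), ((- 2^-1 - u, 2^-1), (u ^+ 2 + u) / 2).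
split=> [||| i| i]; rewrite !aff_parabola ?SjR ?PjR -?/u.
- by split; field.
- by split; field.
- by split; field.
- move=> /(neq_val _ _ _ erefl); rewrite neq_ltn => /orP[/ltR|/ltR];
    by rewrite -/u => iu; split; nra.
- move=> /(neq_val _ _ _ erefl) i1 /(neq_val _ _ _ Sj) i2.
  have /orP[/ltR|/ltR] : (i < j)%N || (j.+1 < i)%N by lia.
    by rewrite -/u => iu; nra.
  by rewrite -natr1 -/u => iu; nra.
Qed.

Lemma parabola_convex (R : realType) k : (2 < k)%N -> convex_polygon (@parabola R k).
Proof.
move=> k2; split=> j.
  move=> a b a1 b1; have [X [Y [[Xj Yj] [XS YS] [XP YP] XY _]]] :=
    parabola_corner_coordinates R j k2.
  exists (a *: X.1 + b *: Y.1, a * X.2 + b * Y.2).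
  have E p : aff (a *: X.1 + b *: Y.1, a * X.2 + b * Y.2) p = a * aff X p + b * aff Y p.
    by rewrite /aff /dot /= /GRing.scale /=; ring.
  split; rewrite ?E ?Xj ?Yj ?XS ?YS ?XP ?YP; try lra.
  by move=> i /XY[X0 [Y0 XY1]]; rewrite E; nra.
have [X [Y [[_ Yj] [_ YS] _ _ Y0]]] := parabola_corner_coordinates R j k2.
by exists Y.
Qed.

(** * Drawing the graphs *)

Lemma affD (R : realType) (h : plane R * R) (a b : R) (p q : plane R) :
  a + b = 1 -> aff h (a *: p + b *: q) = a * aff h p + b * aff h q.
Proof. by move=> ab; rewrite /aff dotD !dotZ -(addKr a b) ab; ring. Qed.

(* [(PA, j)], [(PB, j)], [(PU, j)] stand for v_(2j+1), v_(2j+2) and u_j, with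
   [j] taken modulo [k]: u_k is [(PU, 0)]. *)
Inductive point_kind := PA | PB | PU.

Definition point (R : realType) k (e : 'I_k -> plane R) (x : point_kind * 'I_k) :=
  match x.1 with
  | PA => (3 / 4) *: e x.2 + (1 / 4) *: e (ord_pred x.2)
  | PB => (3 / 4) *: e x.2 + (1 / 4) *: e (ordS x.2)
  | PU => (15 / 16) *: e x.2 +
          (1 / 16) *: ((1 / 2) *: e (ord_pred x.2) + (1 / 2) *: e (ordS x.2))
  end.

(** In turn v_(2j+1)v_(2j+2), v_(2j+2)v_(2j+3), u_jv_(2j+3) and u_jv_(2j); cyclic indices absorb the
    exceptional edges u_(k-1)v_1 and u_kv_3. *)
Inductive edge_kind := EAB | EBA | EUA | EUB.

Definition edge_ends k (q : edge_kind * 'I_k) :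
    (point_kind * 'I_k) * (point_kind * 'I_k) :=
  match q.1 with
  | EAB => ((PA, q.2), (PB, q.2))
  | EBA => ((PB, q.2), (PA, ordS q.2))
  | EUA => ((PU, q.2), (PA, ordS q.2))
  | EUB => ((PU, q.2), (PB, ord_pred q.2))
  end.

Lemma aff_PA (R : realType) k (e : 'I_k -> plane R) h j :
  aff h (point e (PA, j)) = 3 / 4 * aff h (e j) + 1 / 4 * aff h (e (ord_pred j)).
Proof. by rewrite /point /= affD //; lra. Qed.

Lemma aff_PB (R : realType) k (e : 'I_k -> plane R) h j :
  aff h (point e (PB, j)) = 3 / 4 * aff h (e j) + 1 / 4 * aff h (e (ordS j)).
Proof. by rewrite /point /= affD //; lra. Qed.

Lemma aff_PU (R : realType) k (e : 'I_k -> plane R) h j :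
  aff h (point e (PU, j)) =
  15 / 16 * aff h (e j) + 1 / 32 * (aff h (e (ord_pred j)) + aff h (e (ordS j))).
Proof. by rewrite /point /= !affD; lra. Qed.

Definition aff_point := (aff_PA, aff_PB, aff_PU).

(* With X, Y the coordinates at the corner [e j], the point u_j minimises X + Y,
   v_(2j+1) minimises 9X + Y, and v_(2j+2) minimises X + 9Y. *)
Lemma point_exposed (R : realType) k (e : 'I_k -> plane R) x :
  convex_polygon e ->
  exists h, forall y, y <> x -> aff h (point e x) < aff h (point e y).
Proof.
move=> [corner _]; case: x => t j.
pose a : R := if t is PA then 9 else 1; pose b : R := if t is PB then 9 else 1.
have a1 : 1 <= a by rewrite /a; case: (t) => /=; lra.
have b1 : 1 <= b by rewrite /b; case: (t) => /=; lra.
have [h [hj hS hP h1]] := corner j a b a1 b1.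
exists h => -[t' i] tij.
have ge0 l : 0 <= aff h (e l).
  by have [->|/h1] := eqVneq l j; rewrite ?hj; lra.
have [E|/h1 i1] := eqVneq i j; last first.
  (* A point at another corner gives that corner weight at least 3/4 and value at least 1; the value
     to beat is at most 1/4. *)
  have := ge0 (ordS i); have := ge0 (ord_pred i).
  by case: t @a @b a1 b1 hS hP {tij} => a b _ _ hS hP; case: t';
    rewrite !aff_point ?hj ?hS ?hP /a /b; lra.
subst i; case: t @a @b a1 b1 hS hP tij => a b _ _ hS hP; case: t' => tij; try by case: tij.
all: by rewrite !aff_point ?hj ?hS ?hP /a /b; lra.
Qed.

Lemma ordS_neq k (i : 'I_k) : (1 < k)%N -> ordS i != i.
Proof.
move=> k1; apply/eqP => /(congr1 val) /=; have := ltn_ord i.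
have [ik|ik] := eqVneq i.+1 k; first by rewrite ik modnn; lia.
by move=> ?; rewrite modn_small; lia.
Qed.

Lemma ordSS_neq k (i : 'I_k) : (2 < k)%N -> ordS (ordS i) != i.
Proof.
move=> k2; apply/eqP => /(congr1 val) /=; have ik := ltn_ord i.
have [ik1|ik1] := eqVneq i.+1 k; first by rewrite ik1 modnn modn_small; lia.
rewrite (@modn_small i.+1); last lia.
have [ik2|ik2] := eqVneq i.+2 k; first by rewrite ik2 modnn; lia.
by rewrite modn_small; lia.
Qed.

(** Twice the value of the form at the midpoint. *)
Definition edge_value (R : realType) k (pt : point_kind * 'I_k -> plane R) h q :=
  aff h (pt (edge_ends q).1) + aff h (pt (edge_ends q).2).

(* The midpoint of v_(2j+2)v_(2j+3) is exposed by the side of the polygon through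
   it; the other three kinds by X + Y, X + 3Y and 3X + Y at the corner [e j]. *)
Lemma midpoint_exposed (R : realType) k (e : 'I_k -> plane R) q :
  (2 < k)%N -> convex_polygon e ->
  exists h, forall q', q' <> q ->
    edge_value (point e) h q < edge_value (point e) h q'.
Proof.
move=> k2 [corner side]; case: q => t j.
have [{t}->|tN] : t = EBA \/ t <> EBA by case: t; [right|left|right|right].
  have [h [hj hS h0]] := side j; exists h => -[t' i] tij.
  have ge0 l : 0 <= aff h (e l).
    have [->|lj] := eqVneq l j; first by rewrite hj.
    have [->|lS] := eqVneq l (ordS j); first by rewrite hS.
    exact/ltW/h0.
  (* As [k > 2], the side is the only pair of consecutive corners on its line. *)
  have two l : l != j -> 0 < aff h (e l) + aff h (e (ordS l)).
    move=> lj; have [lS|lS] := eqVneq l (ordS j); last exact: ltr_wpDr (h0 _ lj lS).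
    apply: ltr_wpDl => //; apply: h0; last by rewrite (inj_eq (@ordS_inj _)).
    by rewrite lS ordSS_neq.
  have three : 0 < aff h (e (ord_pred i)) + aff h (e i) + aff h (e (ordS i)).
    have [ij|/two i2] := eqVneq i j; last by have := ge0 (ord_pred i); lra.
    have := two (ord_pred i); rewrite ord_predK => H.
    apply: ltr_wpDr => //; apply: H.
    by rewrite -(inj_eq (@ordS_inj _)) ord_predK ij eq_sym ordS_neq // ltnW.
  have := ge0 (ordS i); have := ge0 (ord_pred i); have := ge0 i.
  case: t' tij => tij; rewrite /edge_value /= !aff_point ?ordSK ?ord_predK ?hj ?hS; try lra.
  suff /two : i != j by lra.
  by apply/eqP => ij; apply: tij; rewrite ij.
pose a : R := if t is EUB then 3 else 1; pose b : R := if t is EUA then 3 else 1.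
have a1 : 1 <= a by rewrite /a; case: (t) => /=; lra.
have b1 : 1 <= b by rewrite /b; case: (t) => /=; lra.
have [h [hj hS hP h1]] := corner j a b a1 b1.
exists h => -[t' i] tij.
have ge0 l : 0 <= aff h (e l).
  by have [->|/h1] := eqVneq l j; rewrite ?hj; lra.
(* Two consecutive corners are not both [e j]. Hence [EBA] edges, and all edges indexed by another
   corner, have value at least 1, against 1/2 for [EAB] and 7/8 for [EUA] and [EUB] at [j]. *)
have two : 1 <= aff h (e i) + aff h (e (ordS i)).
  have [ij|/h1] := eqVneq i j; last by have := ge0 (ordS i); lra.
  have /h1 : ordS i != j by rewrite -ij ordS_neq // ltnW.
  by have := ge0 i; lra.
have [E|/h1 i1] := eqVneq i j; last first.
  have := ge0 (ordS i); have := ge0 (ord_pred i).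
  by case: t @a @b a1 b1 hS hP {tij} tN => a b _ _ hS hP //; case: t' => _;
    rewrite /edge_value /= !aff_point ?ordSK ?ord_predK ?hj ?hS ?hP /a /b;
    have := ge0 (ordS (ordS i)); have := ge0 (ord_pred (ord_pred i)); lra.
subst i; case: t @a @b a1 b1 hS hP tij tN => a b _ _ hS hP tij tN; case: t' tij => tij;
  try by case: tij.
all: try by case: tN.
all: have := ge0 (ordS (ordS j)); have := ge0 (ord_pred (ord_pred j)).
all: by move: two; rewrite /edge_value /= !aff_point ?ordSK ?ord_predK ?hj ?hS ?hP
  /a /b; lra.
Qed.

Lemma half_ord_subproof k (a : 'I_(2 * k)) : (a./2 < k)%N.
Proof. by have := ltn_ord a; lia. Qed.

(** The index [c] stands for u_(c+1), hence [ordS], which sends u_k to corner 0. *)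
Definition H_position k (x : H k) : point_kind * 'I_k :=
  match x with
  | inl a => (if odd a then PB else PA, Ordinal (half_ord_subproof a))
  | inr c => (PU, ordS c)
  end.

Lemma H_position_inj k : injective (@H_position k).
Proof.
move=> [a|c] [b|d] //=; try by case: odd.
  move=> [ab hab]; congr inl; apply: val_inj => /=.
  rewrite -(odd_double_half a) -(odd_double_half b).
  by move: ab hab; case: (odd a); case: (odd b) => //= _ ->.
by move=> /(congr1 snd) /ordS_inj ->.
Qed.

Lemma val_ordS k (i : 'I_k) : ordS i = (if i.+1 == k then 0%N else i.+1) :> nat.
Proof.
case: eqVneq => [ik|ik] /=; first by rewrite ik modnn.
by rewrite modn_small //; have := ltn_ord i; lia.
Qed.

Lemma H_list_edge k (x y : H k) : (2 <= k)%N -> H_list x y ->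
  exists q, edge_ends q = (H_position x, H_position y) \/
            edge_ends q = (H_position y, H_position x).
Proof.
move=> k2; case: x y => [a|c] [b|d] //= xy.
  have ak := ltn_ord a; have bk := ltn_ord b.
  have [oa|oa] := boolP (odd a).
    exists (EBA, Ordinal (half_ord_subproof a)); left.
    have /negPf -> : ~~ odd b by lia.
    rewrite /edge_ends /=; congr (_, (_, _)); apply: ord_inj; rewrite val_ordS /=.
    by case: ifP; lia.
  exists (EAB, Ordinal (half_ord_subproof a)); left.
  have -> : odd b by lia.
  by rewrite /edge_ends /=; congr (_, (_, _)); apply: ord_inj => /=; lia.
have ck := ltn_ord c; have bk := ltn_ord b.
have [ob|ob] := boolP (odd b).
  exists (EUB, ordS c); left.
  rewrite /edge_ends /= ordSK; congr (_, (_, _)); apply: ord_inj => /=; lia.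
exists (EUA, ordS c); left.
rewrite /edge_ends /=; congr (_, (_, _)); apply: ord_inj; rewrite !val_ordS /=.
by do ![case: ifP]; lia.
Qed.

(** Changing the sign turns affine forms minimal at a point into linear forms maximal there. *)
Lemma H_exposed_drawing (R : realType) k (pt : point_kind * 'I_k -> plane R) :
  (2 <= k)%N ->
  (forall x, exists h, forall y, y <> x -> aff h (pt x) < aff h (pt y)) ->
  (forall q, exists h, forall q', q' <> q ->
    edge_value pt h q < edge_value pt h q') ->
  exposed_drawing (pt \o @H_position k).
Proof.
move=> k2 expv expm.
have dotN (h : plane R * R) p : dot (- h.1) p = h.2 - aff h p.
  by rewrite /aff /dot /=; lra.
have edgeP (x y : H k) : adj x y -> exists q,
    edge_ends q = (H_position x, H_position y) \/
    edge_ends q = (H_position y, H_position x).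
  move=> /orP[/(H_list_edge k2)//|/(H_list_edge k2)[q qP]].
  by exists q; case: qP; [right | left].
have valE h q x y : edge_ends q = (H_position x, H_position y) \/
    edge_ends q = (H_position y, H_position x) ->
    edge_value pt h q = aff h (pt (H_position x)) + aff h (pt (H_position y)).
  by rewrite /edge_value => -[] -> //=; rewrite addrC.
split=> [x|x y /edgeP[q qP]].
  have [h hx] := expv (H_position x); exists (- h.1) => y yx.
  rewrite !dotN /=; have /hx : H_position y <> H_position x by move/H_position_inj.
  by lra.
have [h hq] := expm q; exists (- h.1) => z w /edgeP[q' q'P].
have [qq|qq] := pselect (q' = q).
  left; move: q'P; rewrite qq.
  by case: qP => -> -[] [] /H_position_inj -> /H_position_inj ->; [left|right|right|left].
right; have := hq _ qq; rewrite (valE _ _ _ _ qP) (valE _ _ _ _ q'P).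
by rewrite !dotD !dotN /=; lra.
Qed.

(** A square v_1v_2v_3v_4 with u_1 and u_2 beyond two opposite sides, each joined to the ends of the
    far side. *)
Definition H2_point (R : realType) (x : point_kind * 'I_2) : plane R :=
  let s := (-1) ^+ x.2 in
  match x.1 with
  | PA => (2 * s, - 2 * s)
  | PB => (- 2 * s, - 2 * s)
  | PU => (0, - 5 * s)
  end.

Lemma H2_exposed_drawing (R : realType) :
  exposed_drawing (@H2_point R \o @H_position 2).
Proof.
have sgnE (i : 'I_2) : (-1) ^+ i = 1 :> R \/ (-1) ^+ i = -1 :> R.
  by case: i => [[|[|//]] ?] /=; [left | right].
have sgnN (i j : 'I_2) : i <> j -> (-1) ^+ i = - (-1) ^+ j :> R.
  case: i j => [[|[|//]] ?] [[|[|//]] ?] ij //=; rewrite ?expr1 ?opprK //;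
    by case: ij; apply: val_inj.
have sgnS (i : 'I_2) : (-1) ^+ ordS i = - (-1) ^+ i :> R.
  by apply: sgnN; apply/eqP; exact: ordS_neq.
have sgnP (i : 'I_2) : (-1) ^+ ord_pred i = - (-1) ^+ i :> R.
  by rewrite -{2}[i]ord_predK sgnS opprK.
apply: H_exposed_drawing => // [[t j]|[t j]].
  (* Half the gradient of 2x^2 + y^2, negated; with x^2 + y^2 the points [PU] would overtake the
     square's corners. *)
  exists (((- 2 * (H2_point R (t, j)).1, - (H2_point R (t, j)).2) : plane R), 0).
  move=> [t' i] tij.
  have [ij|/eqP ij] := eqVneq i j.
    subst i; case: (sgnE j) => sj; case: t t' tij => -[] tij; try (by case: tij);
      by rewrite /aff /dot /H2_point /= sj; lra.
  have := sgnN _ _ ij; case: (sgnE j) => sj; case: t t' {tij} => -[] => si;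
    by rewrite /aff /dot /H2_point /= si sj; lra.
pose p := H2_point R (edge_ends (t, j)).1 + H2_point R (edge_ends (t, j)).2.
exists (- p, 0) => -[t' i] tij.
have [ij|/eqP ij] := eqVneq i j.
  subst i; case: (sgnE j) => sj; case: t t' @p tij => -[] p tij; try (by case: tij);
    by rewrite /p /edge_value /aff /dot /H2_point /= ?sgnS ?sgnP ?sj; lra.
have := sgnN _ _ ij; case: (sgnE j) => sj; case: t t' @p {tij} => -[] p si;
  by rewrite /p /edge_value /aff /dot /H2_point /= ?sgnS ?sgnP ?si ?sj; lra.
Qed.

Lemma H_has_exposed_drawing (R : realType) k : (2 <= k)%N ->
  exists f : H k -> plane R, exposed_drawing f.
Proof.
rewrite leq_eqVlt => /orP[/eqP <-|k2].
  by exists (@H2_point R \o @H_position 2); exact: H2_exposed_drawing.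
have conv := parabola_convex R k2.
exists (point (@parabola R k) \o @H_position k).
apply: H_exposed_drawing => [|x|q]; first exact: ltnW.
- exact: point_exposed.
- exact: midpoint_exposed.
Qed.

Theorem theorem9 (R : realType) :
  (forall k : nat, (2 <= k)%N -> Gss R (H k)) /\
  (forall n : nat, (9 <= n)%N ->
     exists G : sgraph, [/\ #|G| = n, ~ planar R G & Gss R G]).
Proof.
split=> [k /(H_has_exposed_drawing R)[f]|n n9]; first exact: exposed_drawing_Gss.
(* The induction carries an exposed drawing, which adding an isolated vertex preserves; it starts
   from [H 3] with 6 + 3 vertices. *)
suff [G [cG nG [f fG]]] : exists G : sgraph, [/\ #|G| = n, ~ planar R G &
    exists f : G -> plane R, exposed_drawing f].
  by exists G; split=> //; exact: exposed_drawing_Gss fG.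
rewrite -(subnK n9); elim: (n - 9)%N => [|m [G [cG nG [f fG]]]].
  exists (H 3); split; first by rewrite card_sum !card_ord.
  - exact: H3_not_planar.
  - exact: H_has_exposed_drawing.
have /card_gt0P[p _] : (0 < #|G|)%N by rewrite cG addnS.
exists (add_isolated G); split; first by rewrite card_option cG addSn.
- by move/planar_add_isolated.
- exact: exposed_add_isolated p fG.
Qed.
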